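(* Let $R$ be an evenly graded commutative ring in which $2$ is invertible, and let $d$ be an odd integer. The $R$-universal odd Moore algebra of degree $d$ with $v(t)=0$, i.e. the odd Moore algebra over $R[w_1,w_2,\ldots]$ (with $|w_i|=2i(d+2)-2$ and augmentation $w_i\mapsto0$) with $A_\infty$-structure $$\sum_{i=1}^\infty w_it^{2i}\partial_\tau+ad\tau-\tau^2\partial_\tau,$$ is a miniversal deformation of the trivial odd Moore algebra $A:=R[X]/X^2$ of degree $d$, i.e. of the odd Moore algebra over $R$ with $A_\infty$-structure $ad\tau-\tau^2\partial_\tau$.
   Context: Evenly graded means concentrated in even degrees. For an evenly graded commutative ring $\Lambda$, $\Lambda[[\tau,t]]$ denotes the graded $\Lambda$-algebra of formal power series in two non-commuting variables with $|\tau|=-1$, $|t|=-(d+2)$ (elements of $\Lambda$ are central), with its natural topology. All derivations are graded derivations; $A\,\partial_\tau+B\,\partial_t$ denotes the continuous derivation with $\tau\mapsto A$, $t\mapsto B$; $ad\tau(x)=[\tau,x]$ is the graded commutator. An odd Moore algebra of degree $d$ over $\Lambda$ is a unital $A_\infty$-structure on the free graded module $\Sigma^{d+1}\Lambda\oplus\Lambda$ ($d$ odd); it is a continuous derivation of $\Lambda[[\tau,t]]$ of degree $-1$ of the form $\sum_{i\ge1}v_it^{2i}\partial_t+\sum_{i\ge1}w_it^{2i}\partial_\tau+ad\tau-\tau^2\partial_\tau$ with $v_i,w_i\in\Lambda$, $|v_i|=2i(d+2)-d-3$, $|w_i|=2i(d+2)-2$ (its square is automatically zero). Deformations. Let $A$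 be a Moore algebra over $R$ with structure $m$. Let $(\Lambda,\varepsilon)$ be an evenly graded unital commutative $R$-algebra with an augmentation $\varepsilon:\Lambda\to R$ (a homomorphism of $R$-algebras), extended coefficientwise to $\varepsilon:\Lambda[[\tau,t]]\to R[[\tau,t]]$. A deformation of $A$ with base $(\Lambda,\varepsilon)$ is a unital $\Lambda$-linear $A_\infty$-structure $\bar m$ on $\Lambda\otimes_RA$ (a Moore algebra over $\Lambda$) with $\varepsilon\bar m=m\varepsilon$. Two deformations $\bar m_1,\bar m_2$ with the same base are equivalent if there is a continuous automorphism $\phi$ of the $\Lambda$-algebra $\Lambda[[\tau,t]]$, of degree $0$, with $\phi\bar m_1=\bar m_2\phi$ and $\varepsilon\phi=\varepsilon$; as throughout, only unital isomorphisms are considered, i.e. $\phi$ has the form $\tau\mapsto\tau+G(t)$, $t\mapsto F(t)$ with $G,F\in\Lambda[[t]]$ having vanishing constant terms and $F$ having invertible coefficient at $t$. A homomorphism of augmented (graded) $R$-algebras $f:(\Lambda,\varepsilon)\to(\Lambda',\varepsilon')$ is a unital $R$-algebra homomorphism with $\varepsilon'f=\varepsilon$; the push-out $f_*\bar m$ of a deformation $\bar m$ with base $\Lambda$ is the deformation with base $\Lambda'$ obtained by applying $f$ to the coefficients, i.e. $f_*\bar m=(f\bar m(\tau))\partial_\tau+(f\bar m(t))\partial_t$. A deformation $\bar m_\Lambda$ of $A$ with base $(\Lambda,\varepsilon)$ is versal if for any deformation $\bar m_{\Lambda'}$ of $A$ with any base $(\Lambda',\varepsilon')$ there is a homomorphism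 of augmented $R$-algebras $f:\Lambda\to\Lambda'$ such that $f_*\bar m_\Lambda$ is equivalent to $\bar m_{\Lambda'}$. A deformation with base $(\Lambda',\varepsilon')$ is infinitesimal if $\ker(\varepsilon')^2=0$. A versal deformation $\bar m_\Lambda$ is miniversal if this $f$ is unique for every infinitesimal deformation of $A$. *)

(* Defs.v *)
From HB Require Import structures.
From mathcomp Require Import all_boot all_order all_algebra.
From mathcomp Require Import finmap boolp.
From mathcomp.multinomials Require Import monalg.
From mathcomp Require Import zify ring.

Set Implicit Arguments.
Unset Strict Implicit.
Unset Printing Implicit Defensive.

Import GRing.Theory.
Local Open Scope ring_scope.

Inductive var := Tau | Tt.

(* [ncps L] is L[[tau, t]]: a series is the family of its coefficients, indexed
   by the words in the two letters. *)
Definition ncps (L : comNzRingType) := seq var -> L.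

Section Ring.
Variable L : comNzRingType.
Implicit Types (x y z : ncps L) (a b : L) (u : seq var).

HB.instance Definition _ := gen_eqMixin (ncps L).
HB.instance Definition _ := gen_choiceMixin (ncps L).

Definition ncps_zero : ncps L := fun=> 0.
Definition ncps_opp x : ncps L := fun u => - x u.
Definition ncps_add x y : ncps L := fun u => x u + y u.

Fact ncps_addA : associative ncps_add.
Proof. by move=> x y z; apply/funext => u; apply: addrA. Qed.
Fact ncps_addC : commutative ncps_add.
Proof. by move=> x y; apply/funext => u; apply: addrC. Qed.
Fact ncps_add0 : left_id ncps_zero ncps_add.
Proof. by move=> x; apply/funext => u; apply: add0r. Qed.
Fact ncps_addN : left_inverse ncps_zero ncps_opp ncps_add.
Proof. by move=> x; apply/funext => u; apply: addNr. Qed.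

HB.instance Definition _ := GRing.isZmodule.Build (ncps L)
  ncps_addA ncps_addC ncps_add0 ncps_addN.

Definition ncps_one : ncps L := fun u => (nilp u)%:R.
Definition ncps_mul x y : ncps L := fun u =>
  \sum_(i < (size u).+1) x (take i u) * y (drop i u).

(* the left quotient of a series by a letter:
   x = x(1) + tau * lquo Tau x + t * lquo Tt x *)
Definition lquo l x : ncps L := fun u => x (l :: u).

Fact ncps_mul_nil x y : ncps_mul x y [::] = x [::] * y [::].
Proof. by rewrite /ncps_mul big_ord1. Qed.

Fact ncps_mul_cons x y l u :
  ncps_mul x y (l :: u) = x [::] * y (l :: u) + ncps_mul (lquo l x) y u.
Proof. by rewrite /ncps_mul big_ord_recl. Qed.

Fact ncps_mulDl : left_distributive ncps_mul +%R.
Proof.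
move=> x y z; apply/funext => u; rewrite {1}/ncps_mul.
under eq_bigr do rewrite mulrDl.
by rewrite big_split.
Qed.
Fact ncps_mulDr : right_distributive ncps_mul +%R.
Proof.
move=> x y z; apply/funext => u; rewrite {1}/ncps_mul.
under eq_bigr do rewrite mulrDr.
by rewrite big_split.
Qed.

Fact ncps_mulCl a x y u :
  ncps_mul (fun v => a * x v) y u = a * ncps_mul x y u.
Proof. by rewrite /ncps_mul mulr_sumr; apply: eq_bigr => i; rewrite mulrA. Qed.
Fact ncps_mulCr a x y u :
  ncps_mul x (fun v => a * y v) u = a * ncps_mul x y u.
Proof. by rewrite /ncps_mul mulr_sumr; apply: eq_bigr => i; rewrite mulrCA. Qed.

Fact lquo_mul l x y : lquo l (ncps_mul x y) =
  ((fun u => x [::] * lquo l y u) : ncps L) + ncps_mul (lquo l x) y.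
Proof. by apply/funext => u; rewrite {1}/lquo ncps_mul_cons. Qed.

Fact ncps_mulA : associative ncps_mul.
Proof.
move=> x y z; apply/funext => u; elim: u x y z => [|l u IH] x y z.
  by rewrite !ncps_mul_nil mulrA.
rewrite !(ncps_mul_cons, ncps_mul_nil) lquo_mul ncps_mulDl.
set p := (X in _ = _ + X); have -> : p = x [::] * ncps_mul (lquo l y) z u
    + ncps_mul (ncps_mul (lquo l x) y) z u by rewrite -ncps_mulCl.
by rewrite -IH mulrDr !mulrA addrA.
Qed.

Fact ncps_mul1l : left_id ncps_one ncps_mul.
Proof.
move=> x; apply/funext => -[|l u]; first by rewrite ncps_mul_nil mul1r.
rewrite ncps_mul_cons mul1r /ncps_mul big1 ?addr0 // => i _.
by rewrite mul0r.
Qed.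
Fact ncps_mul1r : right_id ncps_one ncps_mul.
Proof.
move=> x; apply/funext => u; elim: u x => [|l u IH] x.
  by rewrite ncps_mul_nil mulr1.
by rewrite ncps_mul_cons mulr0 add0r IH.
Qed.
Fact ncps_one_neq0 : ncps_one != 0.
Proof. by apply/eqP => /(congr1 (@^~ [::])) /eqP; rewrite oner_eq0. Qed.

HB.instance Definition _ := GRing.Zmodule_isNzRing.Build (ncps L)
  ncps_mulA ncps_mul1l ncps_mul1r ncps_mulDl ncps_mulDr ncps_one_neq0.

Definition ncps_scale a x : ncps L := fun u => a * x u.

Fact ncps_scaleA a b x : ncps_scale a (ncps_scale b x) = ncps_scale (a * b) x.
Proof. by apply/funext => u; apply: mulrA. Qed.
Fact ncps_scale1 : left_id 1 ncps_scale.
Proof. by move=> x; apply/funext => u; apply: mul1r. Qed.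
Fact ncps_scaleDr : right_distributive ncps_scale +%R.
Proof. by move=> a x y; apply/funext => u; apply: mulrDr. Qed.
Fact ncps_scaleDl x : {morph ncps_scale^~ x : a b / a + b}.
Proof. by move=> a b; apply/funext => u; apply: mulrDl. Qed.

HB.instance Definition _ := GRing.Zmodule_isLmodule.Build L (ncps L)
  ncps_scaleA ncps_scale1 ncps_scaleDr ncps_scaleDl.

Fact ncps_scaleAl a x y : a *: (x * y) = (a *: x) * y.
Proof. by apply/funext => u; apply/esym/ncps_mulCl. Qed.
Fact ncps_scaleAr a x y : a *: (x * y) = x * (a *: y).
Proof. by apply/funext => u; apply/esym/ncps_mulCr. Qed.

HB.instance Definition _ :=
  GRing.Lmodule_isLalgebra.Build L (ncps L) ncps_scaleAl.
HB.instance Definition _ :=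
  GRing.Lalgebra_isAlgebra.Build L (ncps L) ncps_scaleAr.

End Ring.

Section Derivations.
Variables (L : comNzRingType) (d : int).
Implicit Types (x y : ncps L) (a : L) (u : seq var).

Definition gen l : ncps L := fun u =>
  match l, u with Tau, [:: Tau] | Tt, [:: Tt] => 1 | _, _ => 0 end.

(* \sum_j (c j) t^j *)
Definition tseries (c : nat -> L) : ncps L := fun u =>
  if all (fun l => if l is Tt then true else false) u then c (size u) else 0.

(* \sum_(i >= 1) (c i.-1) t^(2i) : coefficient families are indexed from 0 *)
Definition evseries (c : nat -> L) : ncps L :=
  tseries (fun j => if (0 < j)%N && ~~ odd j then c (j./2).-1 else 0).

Definition ldeg l : int := if l is Tau then - 1 else - (d + 2).
Definition wdeg u : int := \sum_(l <- u) ldeg l.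

(* the involution equal to (-1)^n on series of degree n: as L is evenly graded,
   the words occurring in such a series have degree congruent to n modulo 2 *)
Definition gsign x : ncps L := fun u => (-1) ^+ `|wdeg u| * x u.

(* the continuous odd derivation A d/dtau + B d/dt. On
   x = x(1) + tau x' + t x'' the Leibniz rule forces
   D x = A x' + (-1)^|tau| tau D x' + B x'' + (-1)^|t| t D x'',
   and coefficients are then found by recursion on words; see [odd_der_mul] and
   [odd_der_unique]. *)
Fixpoint odd_der_coef (A B x : ncps L) (u : seq var) : L :=
  (A * lquo Tau x + B * lquo Tt x) u +
  (if u is l :: u' then (-1) ^+ `|ldeg l| * odd_der_coef A B (lquo l x) u'
   else 0).
Definition odd_der A B : ncps L -> ncps L := odd_der_coef A B.

(* graded commutator [tau, x]; |tau| is odd *)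
Definition ad_tau x : ncps L := gen Tau * x - gsign x * gen Tau.

Definition moore_op (v w : nat -> L) (x : ncps L) : ncps L :=
  odd_der 0 (evseries v) x + odd_der (evseries w) 0 x
  + ad_tau x - odd_der (gen Tau ^+ 2) 0 x.

Lemma ncpsDE x y u : (x + y) u = x u + y u. Proof. by []. Qed.
Lemma ncpsNE x u : (- x) u = - x u. Proof. by []. Qed.
Lemma ncpsBE x y u : (x - y) u = x u - y u. Proof. by []. Qed.
Lemma ncpsZE a x u : (a *: x) u = a * x u. Proof. by []. Qed.
Lemma ncps0E u : (0 : ncps L) u = 0. Proof. by []. Qed.
Lemma ncps1E u : (1 : ncps L) u = (nilp u)%:R. Proof. by []. Qed.
Lemma ncpsM_nil x y : (x * y) [::] = x [::] * y [::].
Proof. exact: ncps_mul_nil. Qed.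
Lemma ncpsM_cons x y l u :
  (x * y) (l :: u) = x [::] * y (l :: u) + (lquo l x * y) u.
Proof. exact: ncps_mul_cons. Qed.
Definition ncpsE := (ncpsDE, ncpsNE, ncpsZE, ncps0E, ncps1E).

Lemma lquoM l x y : lquo l (x * y) = x [::] *: lquo l y + lquo l x * y.
Proof. exact: lquo_mul. Qed.
Lemma lquoD l x y : lquo l (x + y) = lquo l x + lquo l y.
Proof. by []. Qed.
Lemma lquoZ l a x : lquo l (a *: x) = a *: lquo l x.
Proof. by []. Qed.

Lemma lquo_gen l k : lquo l (gen k) = if l is Tau then
  if k is Tau then 1 else 0 else if k is Tt then 1 else 0.
Proof. by apply/funext => -[|[] u]; case: l; case: k. Qed.

Lemma gen_mul l x u :
  (gen l * x) u = match l, u with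
    Tau, Tau :: u' => x u' | Tt, Tt :: u' => x u' | _, _ => 0 end.
Proof.
case: u => [|k u]; first by rewrite ncpsM_nil /=; case: l; rewrite mul0r.
by rewrite ncpsM_cons lquo_gen; case: l; case: k;
  rewrite /gen mul0r add0r ?mul0r ?mul1r.
Qed.

Lemma ncps_dec x : x = (x [::])%:A + gen Tau * lquo Tau x + gen Tt * lquo Tt x.
Proof.
apply/funext => u; rewrite !ncpsE !gen_mul.
by case: u => [|[] u]; rewrite /= ?mulr1 ?mulr0 ?add0r ?addr0.
Qed.

Lemma odd_der_nil A B x :
  odd_der A B x [::] = A [::] * x [:: Tau] + B [::] * x [:: Tt].
Proof. by rewrite /odd_der /= addr0 ncpsDE !ncpsM_nil. Qed.
Lemma odd_der_cons A B x l u : odd_der A B x (l :: u) =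
  (A * lquo Tau x + B * lquo Tt x) (l :: u) +
  (-1) ^+ `|ldeg l| * odd_der A B (lquo l x) u.
Proof. by []. Qed.

Lemma odd_der_linear A B a x y :
  odd_der A B (a *: x + y) = a *: odd_der A B x + odd_der A B y.
Proof.
apply/funext => u; rewrite !ncpsE.
elim: u x y => [|l u IH] x y; first by rewrite !odd_der_nil !ncpsE; ring.
by rewrite !odd_der_cons !lquoD !lquoZ IH !mulrDr -!scalerAr !ncpsE; ring.
Qed.
Lemma odd_derD A B x y : odd_der A B (x + y) = odd_der A B x + odd_der A B y.
Proof. by have := odd_der_linear A B 1 x y; rewrite !scale1r. Qed.
Lemma odd_der0 A B : odd_der A B 0 = 0.
Proof. by apply: (addrI (odd_der A B 0)); rewrite -odd_derD !addr0. Qed.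
Lemma odd_derZ A B a x : odd_der A B (a *: x) = a *: odd_der A B x.
Proof. by have := odd_der_linear A B a x 0; rewrite !addr0 odd_der0 addr0. Qed.

Lemma odd_der_scalar A B a : odd_der A B a%:A = 0.
Proof.
have E l : lquo l (a%:A : ncps L) = 0.
  by apply/funext => v; rewrite /lquo !ncpsE mulr0.
apply/funext => -[|l u]; last first.
  by rewrite odd_der_cons !E odd_der0 !ncpsE !mulr0 !ncpsE !addr0.
by rewrite odd_der_nil !ncpsE !mulr0 addr0.
Qed.

Lemma odd_der_gen A B l : odd_der A B (gen l) = if l is Tau then A else B.
Proof.
have E0 : odd_der A B 1 = 0 by rewrite -(odd_der_scalar A B 1) scale1r.
apply/funext => -[|k u]; first by rewrite odd_der_nil; case: l => /=; ring.
by rewrite odd_der_cons !lquo_gen; case: l; case: k;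
  rewrite ?E0 ?odd_der0 ?mulr1 ?mulr0 ?addr0 ?add0r.
Qed.

Lemma signZ_mul (m n : int) :
  (-1) ^+ `|m + n| = (-1) ^+ `|m| * (-1) ^+ `|n| :> L.
Proof.
rewrite -exprD -signr_odd -[RHS]signr_odd; congr (_ ^+ nat_of_bool _); lia.
Qed.

Lemma gsign_cons l x u :
  gsign x (l :: u) = (-1) ^+ `|ldeg l| * gsign (lquo l x) u.
Proof. by rewrite /gsign /wdeg big_cons signZ_mul mulrA. Qed.

Lemma odd_der_mul A B x y :
  odd_der A B (x * y) = odd_der A B x * y + gsign x * odd_der A B y.
Proof.
have g0 z : gsign z [::] = z [::] by rewrite /gsign /wdeg big_nil mul1r.
have lD z l : lquo l (odd_der A B z) = lquo l (A * lquo Tau z + B * lquo Tt z)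
    + (-1) ^+ `|ldeg l| *: odd_der A B (lquo l z) by [].
have lG z l : lquo l (gsign z) = (-1) ^+ `|ldeg l| *: gsign (lquo l z).
  by apply/funext => u; rewrite /lquo gsign_cons.
have D0 z : odd_der A B z [::] = (A * lquo Tau z + B * lquo Tt z) [::].
  by rewrite odd_der_nil ncpsDE !ncpsM_nil.
apply/funext => u; elim: u x y => [|l u IH] x y.
  rewrite ncpsDE !ncpsM_nil !D0 !lquoM !mulrDr -!scalerAr.
  by rewrite g0 !(ncpsE, ncpsM_nil); ring.
set P := A * lquo Tau x + B * lquo Tt x.
have K : A * lquo Tau (x * y) + B * lquo Tt (x * y) =
    x [::] *: (A * lquo Tau y + B * lquo Tt y) + P * y.
  by rewrite /P !lquoM !mulrDr -!scalerAr mulrDl scalerDr !mulrA addrACA.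
rewrite [LHS]odd_der_cons K lquoM odd_derD odd_derZ 2!ncpsDE IH ncpsDE.
rewrite [RHS]ncpsDE !(ncpsM_cons, ncpsZE) g0 lG lD D0 odd_der_cons.
by rewrite -/P (mulrDl (lquo l P)) -!scalerAl !ncpsE; ring.
Qed.

Lemma odd_der_unique (D : ncps L -> ncps L) :
    (forall a x y, D (a *: x + y) = a *: D x + D y) ->
    (forall x y, D (x * y) = D x * y + gsign x * D y) ->
  D = odd_der (D (gen Tau)) (D (gen Tt)).
Proof.
move=> Dl Dm; have DD x y : D (x + y) = D x + D y.
  by have := Dl 1 x y; rewrite !scale1r.
have D0 : D 0 = 0 by apply: (addrI (D 0)); rewrite -DD !addr0.
have D1 : D 1 = 0.
  have g1 : gsign 1 = 1.
    by apply/funext => -[|l u]; rewrite /gsign ?mulr0 // /wdeg big_nil mul1r.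
  by have /esym := Dm 1 1; rewrite g1 !mulr1 mul1r -[RHS]addr0 => /addrI.
have Ds a : D a%:A = 0 by have := Dl a 1 0; rewrite !addr0 D0 D1 scaler0 addr0.
have gg l : gsign (gen l) = (-1) ^+ `|ldeg l| *: gen l.
  by apply/funext => -[|k [|? ?]]; rewrite /gsign ncpsE; case: l;
    rewrite /= ?mulr0 //; case: k => /=; rewrite ?mulr0 // /wdeg big_seq1.
apply/funext => x; apply/funext => u; elim: u x => [|l u IH] x;
  rewrite {1}[x]ncps_dec !DD Ds add0r !Dm !gg -!scalerAl !ncpsE !gen_mul.
  by rewrite odd_der_nil !ncpsM_nil /lquo; ring.
by rewrite odd_der_cons -IH !ncpsE; case: l; ring.
Qed.

Lemma moore_op_trivial x : moore_op (fun=> 0) (fun=> 0) x =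
  ad_tau x - odd_der (gen Tau ^+ 2) 0 x.
Proof.
have E : evseries (fun=> 0) = 0.
  by apply/funext => u; rewrite /evseries /tseries if_same; case: ifP.
have E0 : odd_der 0 0 x = 0.
  by apply/funext => u; elim: u x => [|l u IH] x;
    rewrite ?odd_der_nil ?odd_der_cons ?IH !(mul0r, ncpsE, mulr0, addr0).
by rewrite /moore_op E E0 !add0r.
Qed.

End Derivations.

(* Continuity for the topology in which the series vanishing on all words of
   length < N, for N : nat, form a basis of neighbourhoods of 0. *)
Definition ncps_continuous (L : comNzRingType) (f : ncps L -> ncps L) :=
  forall (x : ncps L) (N : nat), exists M : nat, forall y : ncps L,
    (forall u, (size u < M)%N -> y u = x u) ->
    forall u, (size u < N)%N -> f y u = f x u.

Definition map_ncps (L L' : comNzRingType) (f : L -> L') (x : ncps L) :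
  ncps L' := fun u => f (x u).

Lemma odd_der_continuous (L : comNzRingType) (d : int) (A B : ncps L) :
  ncps_continuous (odd_der d A B).
Proof.
have van N : forall z : ncps L, (forall u, (size u <= N)%N -> z u = 0) ->
    forall u, (size u < N)%N -> odd_der d A B z u = 0.
  have prod0 n (C z : ncps L) u : (size u <= n)%N ->
      (forall v, (size v <= n)%N -> z v = 0) -> (C * z) u = 0.
    move=> su hz; apply: big1 => i _; rewrite hz ?mulr0 // size_drop.
    by apply: leq_trans su; apply: leq_subr.
  elim: N => [//|N IH] z hz [|l u] su.
    by rewrite odd_der_nil !hz // !mulr0 addr0.
  by rewrite odd_der_cons ncpsDE !(prod0 N) ?IH ?mulr0 ?addr0 //
    => v sv; apply: hz.
move=> x N; exists N.+1 => y hy u su.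
rewrite -[y](subrK x) odd_derD ncpsDE (van N) ?add0r // => v sv.
by rewrite ncpsBE hy ?subrr.
Qed.

(* An even grading of A: [hom n] is the subgroup A_n, and A is their direct
   sum. *)
Record even_grading (A : comNzRingType) := EvenGrading {
  hom :> int -> A -> Prop;
  hom0 : forall n, hom n 0;
  homB : forall n x y, hom n x -> hom n y -> hom n (x - y);
  hom1 : hom 0 1;
  homM : forall m n x y, hom m x -> hom n y -> hom (m + n) (x * y);
  hom_span : forall x, exists2 s : seq (int * A),
    (forall p, p \in s -> hom p.1 p.2) & x = \sum_(p <- s) p.2;
  hom_free : forall (s : seq int) (c : int -> A), uniq s ->
    (forall n, hom n (c n)) -> \sum_(n <- s) c n = 0 ->
    forall n, n \in s -> c n = 0;
  hom_even : forall n x, odd `|n| -> hom n x -> x = 0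
}.

Definition ncps_hom (L : comNzRingType) (d : int) (gL : even_grading L)
  (n : int) (x : ncps L) := forall u, gL (n - wdeg d u) (x u).

Section Moore.
Variables (d : int) (R : comNzRingType) (gR : even_grading R).

(* |v_i| = 2i(d+2)-d-3 and |w_i| = 2i(d+2)-2, the index i standing for i.+1 *)
Definition vcoefdeg (i : nat) : int := (2 * i.+1)%:Z * (d + 2) - d - 3.
Definition wcoefdeg (i : nat) : int := (2 * i.+1)%:Z * (d + 2) - 2.

Definition is_moore (L : comNzRingType) (gL : even_grading L)
    (m : ncps L -> ncps L) :=
  exists v w : nat -> L,
    [/\ forall i, gL (vcoefdeg i) (v i), forall i, gL (wcoefdeg i) (w i)
      & m = moore_op d v w].

Record base := Base {
  base_alg :> comAlgType R;
  base_grading : even_grading base_alg;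
  base_scalar : forall n r, gR n r -> base_grading n r%:A;
  aug : {rmorphism base_alg -> R};
  aug_scalar : forall r, aug r%:A = r;
  aug_hom : forall n x, base_grading n x -> gR n (aug x)
}.

Record base_morphism (B B' : base) := BaseMorphism {
  base_map :> {lrmorphism B -> B'};
  base_map_hom : forall n x,
    base_grading B n x -> base_grading B' n (base_map x);
  base_map_aug : forall x, aug B' (base_map x) = aug B x
}.

Definition is_deformation (m : ncps R -> ncps R) (B : base)
    (mB : ncps B -> ncps B) :=
  is_moore (base_grading B) mB /\
  forall x, map_ncps (aug B) (mB x) = m (map_ncps (aug B) x).

Definition equivalent (B : base) (m1 m2 : ncps B -> ncps B) :=
  exists phi : {lrmorphism ncps B -> ncps B},
    [/\ bijective phi /\ ncps_continuous phi,
        forall n x, ncps_hom d (base_grading B) n x ->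
          ncps_hom d (base_grading B) n (phi x),
        exists G F : nat -> B,
          [/\ G 0%N = 0 /\ phi (gen B Tau) = gen B Tau + tseries G,
              F 0%N = 0 /\ phi (gen B Tt) = tseries F
            & exists a : B, a * F 1%N = 1],
        forall x, phi (m1 x) = m2 (phi x)
      & forall x, map_ncps (aug B) (phi x) = map_ncps (aug B) x].

Definition pushout (B B' : base) (f : B -> B') (mB : ncps B -> ncps B) :
    ncps B' -> ncps B' :=
  odd_der d (map_ncps f (mB (gen B Tau))) (map_ncps f (mB (gen B Tt))).

Definition versal (m : ncps R -> ncps R) (B : base) (mB : ncps B -> ncps B) :=
  is_deformation m mB /\
  forall (B' : base) (mB' : ncps B' -> ncps B'), is_deformation m mB' ->
    exists f : base_morphism B B', equivalent (pushout f mB) mB'.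

Definition infinitesimal (B : base) :=
  forall x y : B, aug B x = 0 -> aug B y = 0 -> x * y = 0.

Definition miniversal (m : ncps R -> ncps R) (B : base)
    (mB : ncps B -> ncps B) :=
  versal m mB /\
  forall (B' : base) (mB' : ncps B' -> ncps B'),
    is_deformation m mB' -> infinitesimal B' ->
    forall f g : base_morphism B B',
      equivalent (pushout f mB) mB' -> equivalent (pushout g mB) mB' ->
      f =1 g.

End Moore.

Section GradingTheory.
Variables (A : comNzRingType) (g : even_grading A).

Lemma homN n x : g n x -> g n (- x).
Proof. by move=> hx; rewrite -sub0r; apply: homB => //; apply: hom0. Qed.
Lemma homD n x y : g n x -> g n y -> g n (x + y).
Proof. by move=> hx hy; rewrite -[y]opprK; apply/homB/homN. Qed.
Lemma hom_sum n (I : eqType) (r : seq I) (P : pred I) (F : I -> A) :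
  (forall i, i \in r -> P i -> g n (F i)) -> g n (\sum_(i <- r | P i) F i).
Proof.
by move=> hF; rewrite big_seq_cond; elim/big_ind: _ => [||i /andP[]];
  [exact: hom0 | exact: homD | exact: hF].
Qed.

End GradingTheory.

(* R[w_1, w_2, ...], the i-th variable of {malg R[{cmonom nat}]} being w_(i+1);
   a homogeneous element of degree n has, at a monomial k, a coefficient in R
   of degree n - |k|. *)
Section UniversalBase.
Variables (d : int) (R : comNzRingType) (gR : even_grading R).
Local Notation P := {malg R[{cmonom nat}]}.
Implicit Types (k : {cmonom nat}) (p q : P).

Definition mondeg (k : {cmonom nat}) : int :=
  \sum_(i <- finsupp k) (k i)%:Z * wcoefdeg d i.

Definition pol_hom (n : int) (p : P) := forall k, gR (n - mondeg k) p@_k.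

Definition wvar (i : nat) : P := << ucm i >>.

Lemma mondegEw k (D : {fset nat}) : (finsupp k `<=` D)%fset ->
  mondeg k = \sum_(i <- D) (k i)%:Z * wcoefdeg d i.
Proof.
move=> le; rewrite /mondeg (big_fset_incl _ le) // => i _.
by rewrite -cmE_neq0 negbK => /eqP ->; rewrite mul0r.
Qed.
Lemma mondegM k k' : mondeg (mmul k k') = mondeg k + mondeg k'.
Proof.
rewrite {1}/mondeg mdomD (mondegEw (fsubsetUl _ (finsupp k'))).
rewrite (mondegEw (fsubsetUr (finsupp k) _)) -big_split /=.
by apply: eq_bigr => i _; rewrite cmM PoszD mulrDl.
Qed.
Lemma mondeg1 : mondeg mone = 0.
Proof. by rewrite /mondeg mdom1 big_seq_fset0. Qed.

Fact pol_hom0 n : pol_hom n 0.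
Proof. by move=> k; rewrite mcoeff0; apply: hom0. Qed.
Fact pol_homB n p q : pol_hom n p -> pol_hom n q -> pol_hom n (p - q).
Proof. by move=> hp hq k; rewrite mcoeffB; apply: homB. Qed.
Fact pol_homU n r k : gR (n - mondeg k) r -> pol_hom n << r *g k >>.
Proof.
move=> hr k'; rewrite mcoeffU; case: eqP => [<-|_]; first by rewrite mulr1n.
by rewrite mulr0n; apply: hom0.
Qed.
Fact pol_hom1 : pol_hom 0 1.
Proof. by apply: pol_homU; rewrite mondeg1; apply: hom1. Qed.
Fact pol_homM m n p q :
  pol_hom m p -> pol_hom n q -> pol_hom (m + n) (p * q).
Proof.
move=> hp hq k; rewrite mcoeffMl; apply: hom_sum => i _ _.
apply: hom_sum => j _ _; case: eqP => [<-|_]; last first.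
  by rewrite mulr0n; apply: hom0.
rewrite mulr1n mondegM opprD addrACA; exact: homM.
Qed.
Fact pol_hom_span p : exists2 s : seq (int * P),
  (forall a, a \in s -> pol_hom a.1 a.2) & p = \sum_(a <- s) a.2.
Proof.
rewrite [p]monalgE; elim: (msupp p : seq _) => [|k ks [s hs es]].
  by exists [::]; rewrite ?big_nil.
have [t ht et] := hom_span gR p@_k.
exists ([seq (a.1 + mondeg k, << a.2 *g k >>) | a <- t] ++ s).
  move=> b; rewrite mem_cat => /orP[/mapP[a ta ->]|/hs //].
  by apply: pol_homU; rewrite addrK; apply: ht.
rewrite big_cons es big_cat /= big_map {1}et; congr (_ + _).
exact: raddf_sum.
Qed.
Fact pol_hom_free (s : seq int) (c : int -> P) : uniq s ->
  (forall n, pol_hom n (c n)) -> \sum_(n <- s) c n = 0 ->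
  forall n, n \in s -> c n = 0.
Proof.
move=> us hc sc n ns; apply/malgP => k; rewrite mcoeff0.
have := @hom_free _ gR [seq m - mondeg k | m <- s]
  (fun m => (c (m + mondeg k))@_k) _ _ _ (n - mondeg k) _.
rewrite subrK; apply.
- by rewrite map_inj_uniq // => a b /addIr.
- by move=> m; have := hc (m + mondeg k) k; rewrite addrK.
- rewrite big_map; under eq_bigr do rewrite subrK.
  by rewrite -(raddf_sum (mcoeff k)) sc raddf0.
- by apply/mapP; exists n.
Qed.
Fact wcoefdeg_even i : ~~ odd `|wcoefdeg d i|.
Proof. rewrite /wcoefdeg; lia. Qed.
Fact mondeg_even k : ~~ odd `|mondeg k|.
Proof.
rewrite /mondeg; elim/big_ind: _ => //= [a b|i _]; first by lia.
by rewrite abszM oddM (negbTE (wcoefdeg_even i)) andbF.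
Qed.
Fact pol_hom_even n p : odd `|n| -> pol_hom n p -> p = 0.
Proof.
move=> on hp; apply/malgP => k; rewrite mcoeff0.
by apply: (@hom_even _ gR (n - mondeg k)) => //; have := mondeg_even k; lia.
Qed.

Definition pol_grading : even_grading P :=
  EvenGrading pol_hom0 pol_homB pol_hom1 pol_homM pol_hom_span pol_hom_free
    pol_hom_even.

Fact pol_scalar n r : gR n r -> pol_grading n (r%:A).
Proof.
move=> hr k; rewrite mcoeffZ mcoeff1; case: eqP => [->|_].
  by rewrite mulr1 mondeg1 subr0.
by rewrite mulr0; apply: hom0.
Qed.
Fact pol_aug_scalar r : (r%:A : P)@_mone = r.
Proof. by rewrite mcoeffZ mcoeff1 eqxx mulr1. Qed.
Fact pol_aug_hom n (p : P) : pol_grading n p -> gR n p@_mone.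
Proof. by move/(_ mone); rewrite mondeg1 subr0. Qed.

(* the augmentation w_i |-> 0 is the constant coefficient *)
Definition universal_base : base gR :=
  @Base R gR P pol_grading pol_scalar (mcoeff mone) pol_aug_scalar pol_aug_hom.

End UniversalBase.

(* Main.v *)
Require Import Defs.
From HB Require Import structures.
From mathcomp Require Import all_boot all_order all_algebra.
From mathcomp Require Import finmap boolp.
From mathcomp.multinomials Require Import monalg.
From mathcomp Require Import zify ring.

(** In terms of its values on the generators, a Moore structure with
coefficients v, w sends tau to W(t) + tau^2 and t to V(t) + [tau, t]
([moore_opE]); everything below is an identity between such values, because
odd derivations and substitutions are determined by them.

Versality. Given a deformation (V, W), let G = V / (2t), an odd series in t,
and let phi be the substitution tau |-> tau + G, t |-> t. On t, the shift of
tau turns the graded commutator tau t + t tau into itself plus 2 G t = V: this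
is how the coefficients V are absorbed. On tau, the square (tau + G)^2
produces G^2, while the derivation V d/dt sends G to V G / t = 2 G^2. Hence
phi intertwines the structure (0, W + G^2) with (V, W) ([gauge_transform]).
The structure (0, W + G^2) is the push-out of the universal one along the
evaluation of w_i at the coefficients of W + G^2 ([poleval_base]); this
evaluation respects degrees and augmentations because G has degree -1 and
because V and W reduce to 0 under the augmentation
([deformation_trivial]).

Uniqueness. Let I be the augmentation ideal, with I^2 = 0. An equivalence phi
is the identity modulo I, so it fixes every series with coefficients in I
([inker_fixed]); moreover G has coefficients in I, so that G^2 = 0 and
V d/dt (G) = 0. Comparing the values on tau at the words in t alone, where
the remaining terms tau G and G tau do not contribute, gives equality of the
two series W ([infinitesimal_rigid]). The images of the w_i under the
classifying morphism are thus determined by the deformation, and a morphism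
out of R[w_1, w_2, ...] is determined by them ([base_morphism_ext]).

Substitutions, and nearly all identities about them, are obtained from one
fixed-point principle: if A and B have no constant term, the equation
f p = K p + A f(p') + B f(p'') has a single solution, since it computes the
coefficients by recursion on the length of words ([recursion_unique]). The
equation arises from the decomposition x = x(1) + tau x' + t x'' of a
series. *)

Set Implicit Arguments.
Unset Strict Implicit.
Unset Printing Implicit Defensive.

Import GRing.Theory.
Local Open Scope ring_scope.

(** * Recursion on words and series in t *)

Section Series.
Variable L : comNzRingType.
Implicit Types (A B C x y z : ncps L) (c : nat -> L) (u : seq var).

Lemma ncpsME x y u :
  (x * y) u = \sum_(i < (size u).+1) x (take i u) * y (drop i u).
Proof. by []. Qed.

(** A left factor without constant term raises the order of vanishing by one:
this is what makes the recursions on words below well-founded. *)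
Lemma ncpsM_low C z n u : C [::] = 0 -> (size u <= n)%N ->
  (forall v, (size v < n)%N -> z v = 0) -> (C * z) u = 0.
Proof.
move=> C0 su hz; rewrite ncpsME big1 // => -[[|i] /= hi] _.
  by rewrite take0 C0 mul0r.
by rewrite hz ?mulr0 // size_drop; move: hi su; lia.
Qed.

(** Each application of the equation gains one letter in the order of vanishing
of all the D p at once. The index type T is arbitrary so that p may be a
series, a pair of series, or a coefficient sequence. *)
Lemma contraction (T : Type) (D : T -> ncps L) (l1 l2 : T -> T) A B :
    A [::] = 0 -> B [::] = 0 ->
    (forall p, D p = A * D (l1 p) + B * D (l2 p)) ->
  forall p, D p = 0.
Proof.
move=> A0 B0 DE p; apply/funext => u.
elim: (size u).+1 {-2}u (ltnSn (size u)) p => {u} [//|n IH] u su p.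
by rewrite DE ncpsDE !(ncpsM_low (n := n)) ?addr0 // => v sv; apply: IH.
Qed.

(** The form used to compare two expressions: it suffices that both satisfy the
same recursion over the decomposition of series by their first letter. *)
Lemma recursion_unique (T : Type) (K f g : T -> ncps L) (l1 l2 : T -> T) A B :
    A [::] = 0 -> B [::] = 0 ->
    (forall p, f p = K p + A * f (l1 p) + B * f (l2 p)) ->
    (forall p, g p = K p + A * g (l1 p) + B * g (l2 p)) ->
  f =1 g.
Proof.
move=> A0 B0 fE gE p; apply/eqP; rewrite -subr_eq0; apply/eqP.
apply: (contraction (D := fun p => f p - g p) (l1 := l1) (l2 := l2) A0 B0).
move=> {}p; rewrite fE gE !mulrBr opprD addrACA; congr (_ + _).
by rewrite opprD addrACA subrr add0r.
Qed.

Lemma lquo_tseries l c : lquo l (tseries c) =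
  if l is Tt then tseries (fun j => c j.+1) else 0.
Proof. by case: l. Qed.

Lemma tseries_nil c : tseries c [::] = c 0%N. Proof. by []. Qed.

Lemma tseries_nseq c j : tseries c (nseq j Tt) = c j.
Proof. by rewrite /tseries all_nseq orbT size_nseq. Qed.

Lemma tseries_rec c :
  tseries c = (c 0%N)%:A + gen L Tt * tseries (fun j => c j.+1).
Proof. by rewrite {1}[tseries c]ncps_dec !lquo_tseries mulr0 addr0. Qed.

Lemma eq_tseries c c' : c =1 c' -> tseries c = tseries c'.
Proof. by move=> e; congr tseries; apply/funext. Qed.

Lemma tseriesD c c' : tseries c + tseries c' = tseries (fun j => c j + c' j).
Proof.
by apply/funext => u; rewrite ncpsDE /tseries; case: ifP; rewrite ?addr0.
Qed.

Lemma tseriesN c : - tseries c = tseries (fun j => - c j).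
Proof.
by apply/funext => u; rewrite ncpsNE /tseries; case: ifP; rewrite ?oppr0.
Qed.

Lemma tseries0 : tseries (fun=> 0) = 0 :> ncps L.
Proof. by apply/funext => u; rewrite /tseries if_same. Qed.

Lemma tseriesM c c' : tseries c * tseries c' =
  tseries (fun n => \sum_(i < n.+1) c i * c' (n - i)%N).
Proof.
apply/funext => u; rewrite ncpsME /tseries; case: ifP => hu; last first.
  rewrite big1 // => i _; move: hu; rewrite -{1}(cat_take_drop i u) all_cat.
  by case: all; case: all; rewrite ?mul0r ?mulr0.
apply: eq_bigr => i _; have si : (i <= size u)%N by rewrite -ltnS.
move: hu; rewrite -{1}(cat_take_drop i u) all_cat => /andP[-> ->].
by rewrite size_drop size_takel.
Qed.

Lemma tseriesC c c' : tseries c * tseries c' = tseries c' * tseries c.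
Proof.
rewrite !tseriesM; apply: eq_tseries => n.
rewrite (reindex_inj rev_ord_inj); apply: eq_bigr => i _ /=.
by rewrite mulrC subSS subKn // -ltnS.
Qed.

Lemma gen_tseries : gen L Tt = tseries (fun j => (j == 1%N)%:R).
Proof. by apply/funext => -[|[] [|[] u]]; rewrite // /tseries /= if_same. Qed.

Lemma gen_mul_tseries c :
  gen L Tt * tseries c = tseries (fun j => if j is j'.+1 then c j' else 0).
Proof. by rewrite [RHS]tseries_rec scale0r add0r. Qed.

Lemma gen_tseriesC c : gen L Tt * tseries c = tseries c * gen L Tt.
Proof. by rewrite gen_tseries tseriesC. Qed.

End Series.

(** * Odd derivations *)

Section OddDerivations.
Variables (L : comNzRingType) (d : int).
Hypothesis hd : odd `|d|.
Implicit Types (A B P Q x y : ncps L) (c v w : nat -> L) (u : seq var).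

Lemma ldeg_sign l : (-1) ^+ `|ldeg d l| = -1 :> L.
Proof.
suff o : odd `|ldeg d l| by rewrite -signr_odd o.
by case: l => //=; lia.
Qed.

Lemma wdeg_cat u u' : wdeg d (u ++ u') = wdeg d u + wdeg d u'.
Proof. by rewrite /wdeg big_cat. Qed.

Lemma gsignD x y : gsign d (x + y) = gsign d x + gsign d y.
Proof. by apply/funext => u; rewrite /gsign !ncpsDE mulrDr. Qed.

Lemma gsignZ (a : L) x : gsign d (a *: x) = a *: gsign d x.
Proof. by apply/funext => u; rewrite /gsign !ncpsZE mulrCA. Qed.

Lemma gsignM x y : gsign d (x * y) = gsign d x * gsign d y.
Proof.
apply/funext => u; rewrite {1}/gsign !ncpsME mulr_sumr; apply: eq_bigr => i _.
by rewrite /gsign mulrACA -signZ_mul -wdeg_cat cat_take_drop.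
Qed.

Lemma gsign_gen l : gsign d (gen L l) = - gen L l.
Proof.
apply/funext => -[|k [|k' u]]; rewrite /gsign ncpsNE.
- by case: l; rewrite mulr0 oppr0.
- by rewrite /wdeg big_seq1 ldeg_sign mulN1r.
- by case: l; case: k; rewrite mulr0 oppr0.
Qed.

Lemma gsign_tseries c :
  gsign d (tseries c) = tseries (fun j => (-1) ^+ j * c j).
Proof.
apply/funext => u; rewrite /gsign /tseries.
case: ifP => _; last by rewrite mulr0.
congr (_ * _); elim: u => [|l u IH]; first by rewrite /wdeg big_nil.
by rewrite /wdeg big_cons signZ_mul ldeg_sign IH exprS.
Qed.

(** The Leibniz rule on x = x(1) + tau x' + t x''; the two minus signs come
from tau and t being odd, the latter because d is. *)
Lemma odd_der_rec A B x : odd_der d A B x =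
  A * lquo Tau x + B * lquo Tt x
  - (gen L Tau * odd_der d A B (lquo Tau x)
     + gen L Tt * odd_der d A B (lquo Tt x)).
Proof.
apply/funext => -[|l u]; rewrite ncpsBE !ncpsDE !gen_mul.
  by rewrite odd_der_nil !ncpsM_nil addr0 subr0.
rewrite odd_der_cons ldeg_sign mulN1r !ncpsDE.
by case: l; rewrite ?addr0 ?add0r.
Qed.

Lemma odd_derDl A A' B B' x :
  odd_der d (A + A') (B + B') x = odd_der d A B x + odd_der d A' B' x.
Proof.
pose D z := odd_der d A B z + odd_der d A' B' z.
have lin a y z : D (a *: y + z) = a *: D y + D z.
  by rewrite /D !odd_der_linear scalerDr addrACA.
have der y z : D (y * z) = D y * z + gsign d y * D z.
  by rewrite /D !odd_der_mul mulrDl mulrDr addrACA.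
by have := congr1 (@^~ x) (odd_der_unique lin der); rewrite /D !odd_der_gen.
Qed.

(** The graded commutator with tau is a graded derivation, so its values on
generators determine it: [tau, tau] = 2 tau^2 and [tau, t] = tau t + t tau. *)
Lemma ad_tau_odd_der x :
  ad_tau d x = odd_der d (gen L Tau ^+ 2 *+ 2)
    (gen L Tau * gen L Tt + gen L Tt * gen L Tau) x.
Proof.
have lin a y z : ad_tau d (a *: y + z) = a *: ad_tau d y + ad_tau d z.
  rewrite /ad_tau gsignD gsignZ mulrDr mulrDl -scalerAr -scalerAl.
  by rewrite scalerBr opprD addrACA.
have der y z : ad_tau d (y * z) = ad_tau d y * z + gsign d y * ad_tau d z.
  rewrite /ad_tau gsignM mulrBl mulrBr !mulrA.
  by rewrite addrA subrK.
rewrite (odd_der_unique lin der); congr (odd_der d _ _ x);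
  by rewrite /ad_tau gsign_gen mulNr opprK ?mulr2n.
Qed.

(** Replaces the four-term operator by a single derivation; the value on tau is
W + 2 tau^2 - tau^2. *)
Lemma moore_opE v w : moore_op d v w =
  odd_der d (evseries w + gen L Tau ^+ 2)
    (evseries v + (gen L Tau * gen L Tt + gen L Tt * gen L Tau)).
Proof.
apply/funext => x; apply/eqP; rewrite /moore_op ad_tau_odd_der subr_eq.
by rewrite -!odd_derDl !addr0 !add0r -addrA -mulr2n.
Qed.

Lemma odd_der_tau_tseries A c : odd_der d A 0 (tseries c) = 0.
Proof.
have t0 : (- gen L Tt) [::] = 0 by exact: oppr0.
apply: (@contraction _ _ (fun c => odd_der d A 0 (tseries c)) id
  (fun c j => c j.+1) _ _ (erefl ((0 : ncps L) [::])) t0) => {}c.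
by rewrite odd_der_rec !lquo_tseries odd_der0 !mulr0 !mul0r !add0r mulNr.
Qed.

(** As the derivation is odd and its value on t commutes with t, it kills t^2;
hence it kills even powers of t and sends t^(2i+1) to t^(2i) times that
value. *)
Lemma odd_der_t_tseries b c : odd_der d 0 (tseries b) (tseries c) =
  tseries b * tseries (fun j => if odd j then 0 else c j.+1).
Proof.
have t0 : (- gen L Tt) [::] = 0 by exact: oppr0.
move: c; apply: (@recursion_unique _ _
  (fun c => tseries b * tseries (fun j => c j.+1))
  (fun c => odd_der d 0 (tseries b) (tseries c))
  (fun c => tseries b * tseries (fun j => if odd j then 0 else c j.+1))
  id (fun c j => c j.+1) _ _ (erefl ((0 : ncps L) [::])) t0) => c.
  rewrite odd_der_rec !lquo_tseries odd_der0 !mulr0 !mul0r !add0r addr0.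
  by rewrite mulNr.
rewrite mul0r addr0 mulNr mulrA gen_tseriesC -mulrA -mulrBr.
rewrite gen_mul_tseries tseriesN tseriesD; congr (_ * _).
apply: eq_tseries => -[|j] /=; first by rewrite oppr0 addr0.
by case: (odd j); rewrite /= ?oppr0 ?addr0 ?subrr.
Qed.

(** On odd series in t the graded commutator with tau is an anticommutator, and
V d/dt acts as multiplication by V / t. *)
Lemma moore_op_tseries v w c : (forall j, ~~ odd j -> c j = 0) ->
  moore_op d v w (tseries c) =
  evseries v * tseries (fun j => c j.+1)
  + (gen L Tau * tseries c + tseries c * gen L Tau).
Proof.
move=> hc; rewrite /moore_op !odd_der_tau_tseries addr0 subr0.
rewrite odd_der_t_tseries /ad_tau gsign_tseries; congr (_ * _ + _).
  apply: eq_tseries => j; case: ifP => // oj; by rewrite hc //= oj.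
rewrite -mulNr tseriesN; congr (_ + _ * _); apply: eq_tseries => j.
rewrite -signr_odd; have [oj|ej] := boolP (odd j); last first.
  by rewrite hc // mulr0 oppr0.
by rewrite expr1 mulN1r opprK.
Qed.

End OddDerivations.

(** * Substitutions *)

Section Substitution.
Variables (L : comNzRingType) (A B : ncps L).
Hypotheses (A0 : A [::] = 0) (B0 : B [::] = 0).
Implicit Types (x y z : ncps L) (c : nat -> L) (u : seq var).

(** Substituting A for tau and B for t is the solution of the recursion
x |-> x(1) + A x' + B x''. It is not structural: the coefficient at a word u
calls for those of the images of x' and x'' at suffixes of u of any length.
These suffixes are proper as A and B have no constant term, so n steps
determine the coefficients at words of length less than n. *)
Fixpoint subst_upto n x : ncps L :=
  if n is n'.+1 then
    (x [::])%:A + A * subst_upto n' (lquo Tau x) + B * subst_upto n' (lquo Tt x)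
  else 0.

(** Locked, so that unification never unfolds it to coefficients. *)
Definition subst : ncps L -> ncps L :=
  locked (fun x u => subst_upto (size u).+1 x u).

Lemma substE x u : subst x u = subst_upto (size u).+1 x u.
Proof. by rewrite /subst -lock. Qed.

Lemma subst_upto_stable n m x u : (size u < n)%N -> (size u < m)%N ->
  subst_upto n x u = subst_upto m x u.
Proof.
elim: n m x u => [//|n IH] [//|m] x u su su'.
rewrite /= !ncpsDE; congr (_ + _ + _); apply/eqP; rewrite -subr_eq0 -ncpsBE;
  rewrite -mulrBr; apply/eqP; apply: (ncpsM_low (n := size u)) => // v sv;
  rewrite ncpsBE (IH m) ?subrr //; apply: leq_trans sv _; lia.
Qed.

Lemma subst_rec x :
  subst x = (x [::])%:A + A * subst (lquo Tau x) + B * subst (lquo Tt x).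
Proof.
apply/funext => u; rewrite substE [subst_upto _ _]/= !ncpsDE.
congr (_ + _ + _); apply/eqP; rewrite -subr_eq0 -ncpsBE;
  rewrite -mulrBr; apply/eqP; apply: (ncpsM_low (n := size u)) => // v sv;
  by rewrite ncpsBE substE [X in _ - X](@subst_upto_stable _ (size u)) ?subrr.
Qed.

(** A continuous algebra endomorphism with values A, B on the generators
satisfies this recursion. *)
Lemma subst_unique (f : ncps L -> ncps L) :
    (forall x, f x = (x [::])%:A + A * f (lquo Tau x) + B * f (lquo Tt x)) ->
  f =1 subst.
Proof. by move/recursion_unique; apply => //; apply: subst_rec. Qed.

Lemma subst_linear : linear subst.
Proof.
move=> a x y; pose l k (p : ncps L * ncps L) := (lquo k p.1, lquo k p.2).
suff E : (fun p => subst (a *: p.1 + p.2)) =1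
         (fun p => a *: subst p.1 + subst p.2).
  exact: E (x, y).
apply: (@recursion_unique _ _ (fun p => (a * p.1 [::] + p.2 [::])%:A) _ _
  (l Tau) (l Tt) _ _ A0 B0) => -[{}x {}y] /=.
  by rewrite {1}subst_rec !lquoD !lquoZ.
rewrite {1}(subst_rec x) {1}(subst_rec y) !scalerDr scalerDl -scalerA !mulrDr.
rewrite -!scalerAr addrACA; congr (_ + _).
by rewrite addrACA.
Qed.

Lemma subst0 : subst 0 = 0.
Proof.
by have := subst_linear (-1) 0 0; rewrite scaler0 addr0 scaleN1r addNr.
Qed.
Lemma substD x y : subst (x + y) = subst x + subst y.
Proof. by have := subst_linear 1 x y; rewrite !scale1r. Qed.
Lemma substZ a x : subst (a *: x) = a *: subst x.
Proof. by have := subst_linear a x 0; rewrite subst0 !addr0. Qed.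

Lemma subst1 : subst 1 = 1.
Proof.
have l0 l : lquo l (1 : ncps L) = 0 by apply/funext.
by rewrite subst_rec !l0 subst0 !mulr0 !addr0 scale1r.
Qed.

Lemma subst_gen l : subst (gen L l) = if l is Tau then A else B.
Proof.
rewrite subst_rec !lquo_gen.
by case: l; rewrite !(subst0, subst1, mulr1, mulr0, addr0) scale0r add0r.
Qed.

(** With y fixed, both sides satisfy the recursion with first term x(1) times
the image of y. *)
Lemma substM x y : subst (x * y) = subst x * subst y.
Proof.
move: x; apply: (@recursion_unique _ _ (fun x => x [::] *: subst y)
  (fun x => subst (x * y)) (fun x => subst x * subst y)
  (lquo Tau) (lquo Tt) _ _ A0 B0) => x.
  rewrite subst_rec ncpsM_nil !lquoM !substD !substZ {1}(subst_rec y).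
  rewrite !scalerDr !mulrDr -!scalerAr scalerA -!addrA; congr (_ + _).
  by congr (_ + _); rewrite addrCA.
by rewrite {1}(subst_rec x) !mulrDl !mulrA -scalerAl mul1r.
Qed.

Fact subst_multiplicative : monoid_morphism subst.
Proof. by split; [exact: subst1 | exact: substM]. Qed.

Definition subst_lrmorphism : {lrmorphism ncps L -> ncps L} :=
  HB.pack subst
    (GRing.isLinear.Build L (ncps L) (ncps L) _ subst subst_linear)
    (GRing.isMonoidMorphism.Build (ncps L) (ncps L) subst subst_multiplicative).

End Substitution.

Section SubstitutionTheory.
Variable L : comNzRingType.
Implicit Types (A B x y z : ncps L) (c : nat -> L) (u : seq var).

Lemma subst_low A B n x : A [::] = 0 -> B [::] = 0 ->
  (forall v, (size v < n)%N -> x v = 0) ->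
  forall u, (size u < n)%N -> subst A B x u = 0.
Proof.
move=> A0 B0; elim: n x => [//|n IH] x hx u su.
rewrite subst_rec // hx // scale0r add0r ncpsDE.
by rewrite !(ncpsM_low (n := n)) ?addr0 // => v; apply: IH => w sw; apply: hx.
Qed.

Lemma subst_continuous A B : A [::] = 0 -> B [::] = 0 ->
  ncps_continuous (subst A B).
Proof.
move=> A0 B0 x N; exists N => y hy u su.
rewrite -[y](subrK x) substD // ncpsDE (subst_low (n := N)) ?add0r // => v sv.
by rewrite ncpsBE hy ?subrr.
Qed.

Lemma subst_id x : subst (gen L Tau) (gen L Tt) x = x.
Proof.
by apply/esym; apply: (@subst_unique _ _ _ _ _ id) => // {}x; apply: ncps_dec.
Qed.

Lemma subst_comp A B A' B' x : A [::] = 0 -> B [::] = 0 -> A' [::] = 0 ->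
    B' [::] = 0 ->
  subst A B (subst A' B' x) = subst (subst A B A') (subst A B B') x.
Proof.
move=> A0 B0 A0' B0'; move: x; apply: subst_unique => [||x].
- by rewrite (subst_low (n := 1)) // => -[].
- by rewrite (subst_low (n := 1)) // => -[].
by rewrite {1}(subst_rec A0' B0') !substD // substZ // subst1 // !substM.
Qed.

Lemma subst_tseries A c : A [::] = 0 ->
  subst A (gen L Tt) (tseries c) = tseries c.
Proof.
move=> A0; move: c.
apply: (@recursion_unique _ _ (fun c => (c 0%N)%:A)
  (fun c => subst A (gen L Tt) (tseries c)) (@tseries L) id (fun c j => c j.+1)
  0 (gen L Tt)) => // c; rewrite mul0r addr0.
  by rewrite subst_rec // !lquo_tseries tseries_nil subst0 // mulr0 addr0.
exact: tseries_rec.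
Qed.

(** Both composites are derivations along the substitution, so agreement on
generators suffices. The sign conditions say that A and B are odd; they give
both sides the same recursion, with -A and -B as multipliers. *)
Lemma odd_der_subst d A B P Q P' Q' x : odd `|d| ->
    A [::] = 0 -> B [::] = 0 -> gsign d A = - A -> gsign d B = - B ->
    subst A B P = odd_der d P' Q' A -> subst A B Q = odd_der d P' Q' B ->
  subst A B (odd_der d P Q x) = odd_der d P' Q' (subst A B x).
Proof.
move=> hd A0 B0 gA gB eP eQ.
have A0' : (- A) [::] = 0 by rewrite ncpsNE A0 oppr0.
have B0' : (- B) [::] = 0 by rewrite ncpsNE B0 oppr0.
move: x; apply: (@recursion_unique _ _
  (fun x => odd_der d P' Q' A * subst A B (lquo Tau x)
    + odd_der d P' Q' B * subst A B (lquo Tt x))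
  (fun x => subst A B (odd_der d P Q x))
  (fun x => odd_der d P' Q' (subst A B x))
  (lquo Tau) (lquo Tt) _ _ A0' B0') => x.
- rewrite odd_der_rec // -mulN1r mulrDr !mulrA !mulN1r !substD //.
  rewrite !substM // !eP !eQ -!addrA; congr (_ + (_ + (_ * _ + _ * _))).
    by rewrite -scaleN1r substZ // subst_gen // scaleN1r.
  by rewrite -scaleN1r substZ // subst_gen // scaleN1r.
- rewrite {1}(subst_rec A0 B0) !odd_derD odd_der_scalar add0r.
  by rewrite !odd_der_mul gA gB addrACA !addrA.
Qed.

Section Homogeneous.
Variables (d : int) (gL : even_grading L).

Lemma ncps_homM m n x y : ncps_hom d gL m x -> ncps_hom d gL n y ->
  ncps_hom d gL (m + n) (x * y).
Proof.
move=> hx hy u; rewrite ncpsME; apply: hom_sum => i _ _.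
rewrite -{1}(cat_take_drop i u) wdeg_cat opprD addrACA.
exact: homM (hx _) (hy _).
Qed.

Lemma ncps_homD n x y : ncps_hom d gL n x -> ncps_hom d gL n y ->
  ncps_hom d gL n (x + y).
Proof. by move=> hx hy u; apply: homD. Qed.

Lemma ncps_hom_scalar n (a : L) : gL n a -> ncps_hom d gL n a%:A.
Proof.
move=> ha [|l u]; rewrite ncpsZE ncps1E /=.
  by rewrite mulr1 /wdeg big_nil subr0.
by rewrite mulr0; apply: hom0.
Qed.

Lemma ncps_hom_lquo n l x : ncps_hom d gL n x ->
  ncps_hom d gL (n - ldeg d l) (lquo l x).
Proof.
by move=> hx u; have := hx (l :: u); rewrite /wdeg big_cons opprD addrA.
Qed.

Lemma ncps_hom_gen l : ncps_hom d gL (ldeg d l) (gen L l).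
Proof.
case: l => -[|[] [|l u]]; rewrite /gen; do ?exact: hom0;
  by rewrite /wdeg big_seq1 subrr; apply: hom1.
Qed.

Lemma ncps_hom_tseries n c :
    (forall j, gL (n + j%:Z * (d + 2)) (c j)) -> ncps_hom d gL n (tseries c).
Proof.
move=> hc u; rewrite /tseries; case: ifP => [au|_]; last exact: hom0.
suff -> : - wdeg d u = (size u)%:Z * (d + 2) by apply: hc.
elim: u au => [|[] u IH] //=; first by rewrite /wdeg big_nil oppr0 mul0r.
by move/IH; rewrite /wdeg big_cons /= => h; rewrite opprD h; lia.
Qed.

Lemma ncps_hom_subst A B n x : A [::] = 0 -> B [::] = 0 ->
    ncps_hom d gL (ldeg d Tau) A -> ncps_hom d gL (ldeg d Tt) B ->
  ncps_hom d gL n x -> ncps_hom d gL n (subst A B x).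
Proof.
move=> A0 B0 hA hB hx; suff h k : ncps_hom d gL n (subst_upto A B k x).
  by move=> u; rewrite substE; apply: h.
elim: k n x hx => [|k IH] n x hx; first by move=> u; apply: hom0.
apply: ncps_homD; first apply: ncps_homD.
- by apply: ncps_hom_scalar; have := hx [::]; rewrite /wdeg big_nil subr0.
- by rewrite -[n](subrKC (ldeg d Tau)); apply/ncps_homM/IH/ncps_hom_lquo.
- by rewrite -[n](subrKC (ldeg d Tt)); apply/ncps_homM/IH/ncps_hom_lquo.
Qed.

End Homogeneous.
End SubstitutionTheory.

(** * Change of coefficients *)

Section CoefficientMaps.
Variables (L L' : comNzRingType) (f : {rmorphism L -> L'}).
Implicit Types (x y : ncps L) (c v w : nat -> L).
Local Notation "x ^f" := (map_ncps f x).

Lemma map_ncpsD x y : (x + y)^f = x^f + y^f.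
Proof. by apply/funext => u; apply: rmorphD. Qed.
Lemma map_ncpsZ a x : (a *: x)^f = f a *: x^f.
Proof. by apply/funext => u; apply: rmorphM. Qed.

Lemma map_ncps1 : 1^f = 1.
Proof. by apply/funext => u; rewrite /map_ncps !ncps1E rmorph_nat. Qed.
Lemma map_ncpsM x y : (x * y)^f = x^f * y^f.
Proof.
apply/funext => u; rewrite /map_ncps !ncpsME rmorph_sum.
by apply: eq_bigr => i _; apply: rmorphM.
Qed.
Lemma map_ncps_gen l : (gen L l)^f = gen L' l.
Proof.
by apply/funext => -[|[] [|k u]]; case: l;
  rewrite /map_ncps /= ?rmorph0 ?rmorph1.
Qed.
Lemma map_tseries c : (tseries c)^f = tseries (f \o c).
Proof.
by apply/funext => u; rewrite /map_ncps /tseries; case: ifP; rewrite ?rmorph0.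
Qed.
Lemma map_evseries c : (evseries c)^f = evseries (f \o c).
Proof.
rewrite /evseries map_tseries; apply: eq_tseries => j /=.
by case: ifP; rewrite ?rmorph0.
Qed.

Lemma map_odd_der d A B x : (odd_der d A B x)^f = odd_der d A^f B^f x^f.
Proof.
apply/funext => u; elim: u x => [|l u IH] x.
  by rewrite odd_der_nil /map_ncps odd_der_nil rmorphD !rmorphM.
rewrite odd_der_cons -[lquo l x^f]/((lquo l x)^f) -IH.
rewrite -[lquo Tau x^f]/((lquo Tau x)^f) -[lquo Tt x^f]/((lquo Tt x)^f).
rewrite -!map_ncpsM -map_ncpsD /map_ncps odd_der_cons rmorphD rmorphM.
by rewrite rmorph_sign.
Qed.

Lemma map_subst A B x : A [::] = 0 -> B [::] = 0 ->
  (subst A B x)^f = subst A^f B^f x^f.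
Proof.
move=> A0 B0; have A0' : A^f [::] = 0 by rewrite /map_ncps A0 rmorph0.
have B0' : B^f [::] = 0 by rewrite /map_ncps B0 rmorph0.
move: x; apply: (@recursion_unique _ _ (fun x => (x^f [::])%:A)
  (fun x => (subst A B x)^f) (fun x => subst A^f B^f x^f)
  (lquo Tau) (lquo Tt) _ _ A0' B0') => x.
  by rewrite subst_rec // !map_ncpsD !map_ncpsM map_ncpsZ map_ncps1.
by rewrite {1}subst_rec.
Qed.

Lemma map_moore_op d v w x : odd `|d| ->
  (moore_op d v w x)^f = moore_op d (f \o v) (f \o w) x^f.
Proof.
move=> hd; rewrite !moore_opE // map_odd_der; congr (odd_der d _ _ _);
by rewrite !(map_ncpsD, map_evseries, expr2, map_ncpsM, map_ncps_gen).
Qed.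

End CoefficientMaps.

(** * Graded rings and morphisms out of the universal base *)

Section Gradings.
Variables (A : comNzRingType) (g : even_grading A).

(** The part of degree 0 of h is already an inverse of 2, as 1 has degree 0, and
inverses are unique. *)
Lemma hom_half (h : A) : h * 2%:R = 1 -> g 0 h.
Proof.
move=> h2; have [s hs hE] := hom_span g h.
pose part n := \sum_(p <- s | p.1 == n) p.2.
have hpart n : g n (part n).
  by apply: hom_sum => p ps /eqP <-; apply: hs.
pose T := undup (0 :: [seq p.1 | p <- s]).
have sumT : \sum_(n <- T) part n = h.
  rewrite /part (exchange_big_dep predT) //= hE big_seq [RHS]big_seq.
  apply: eq_bigr => p ps.
  rewrite (eq_bigl (pred1 p.1)) => [|n]; last exact: eq_sym.
  rewrite -big_filter filter_pred1_uniq ?undup_uniq ?big_seq1 //.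
  by rewrite mem_undup inE map_f ?orbT.
(* 2h - 1 = 0 is a sum of homogeneous terms, so its part of degree 0
   vanishes. *)
have e : part 0 * 2%:R - (0 == 0 :> int)%:R = 0.
  apply: (@hom_free _ g T (fun n => part n * 2%:R - (n == 0)%:R)).
  - exact: undup_uniq.
  - move=> n; rewrite mulr_natr mulr2n; apply: homB; first exact: homD.
    by case: eqP => [->|_]; [apply: hom1 | apply: hom0].
  - rewrite sumrB -mulr_suml sumT h2 (bigD1_seq 0) ?undup_uniq //=.
      by rewrite big1 ?addr0 ?subrr // => n /negbTE ->.
    by rewrite mem_undup mem_head.
  - by rewrite mem_undup mem_head.
suff -> : h = part 0 by [].
by rewrite -[RHS]mulr1 -h2 mulrCA (subr0_eq e) mulr1.
Qed.

Lemma homX n x k : g n x -> g (k%:Z * n) (x ^+ k).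
Proof.
move=> hx; elim: k => [|k IH]; first by rewrite mul0r; apply: hom1.
by rewrite exprS intS mulrDl mul1r; apply: homM.
Qed.

End Gradings.

Section Evaluation.
Variables (d : int) (R : comNzRingType) (gR : even_grading R) (B' : base gR).
Variable w : nat -> B'.
Hypothesis hw : forall i, base_grading B' (wcoefdeg d i) (w i).
Hypothesis aw : forall i, aug B' (w i) = 0.
Implicit Types (k : {cmonom nat}) (p : {malg R[{cmonom nat}]}).

Definition moneval k : B' := \prod_(i <- finsupp k) w i ^+ k i.

Lemma monevalEw k (D : {fset nat}) : (finsupp k `<=` D)%fset ->
  moneval k = \prod_(i <- D) w i ^+ k i.
Proof.
move=> le; rewrite /moneval (big_fset_incl _ le) // => i _.
by rewrite -cmE_neq0 negbK => /eqP ->.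
Qed.

Fact moneval_morphism : mmorphism moneval.
Proof.
split=> [k k'|]; last by rewrite /moneval mdom1 big_seq_fset0.
rewrite {1}/moneval mdomD (monevalEw (fsubsetUl _ (finsupp k'))).
rewrite (monevalEw (fsubsetUr (finsupp k) _)) -big_split /=.
by apply: eq_bigr => i _; rewrite cmM exprD.
Qed.

HB.instance Definition _ :=
  monalg.isMultiplicative.Build _ _ moneval moneval_morphism.

Lemma monevalU i : moneval (ucm i) = w i.
Proof. by rewrite /moneval mdomU big_seq_fset1 cmUU. Qed.

Lemma moneval_hom k : base_grading B' (mondeg d k) (moneval k).
Proof.
rewrite /moneval /mondeg; elim: (finsupp k : seq nat) => [|i s IH].
  by rewrite !big_nil; apply: hom1.
by rewrite !big_cons; apply: homM => //; apply: homX.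
Qed.

Lemma moneval_aug k : aug B' (moneval k) = (k == mone)%:R.
Proof.
have [->|] := eqVneq k mone; first by rewrite mmorph1 rmorph1.
have [e|[i ik]] := fset_0Vmem (finsupp k).
  by move/negP; case; apply/cmP => i; rewrite cm1; apply/eqP; rewrite cmE_eq0 e.
rewrite /moneval (big_fsetD1 i) //= rmorphM rmorphXn /= aw.
by rewrite expr0n (negbTE (_ : k i != 0)) ?mul0r // cmE_neq0.
Qed.

Definition poleval : universal_base d gR -> B' := mmap (in_alg B') moneval.

Fact poleval_linear : linear poleval.
Proof. by move=> r p q; rewrite /poleval mmapD mmapZ mulr_algl. Qed.
Fact poleval_morphism : monoid_morphism poleval.
Proof.
split=> [|p q]; first exact: mmap1.
exact: (rmorphM (mmap (in_alg B') moneval)). Qed.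

Definition poleval_lr : {lrmorphism universal_base d gR -> B'} :=
  HB.pack poleval
    (GRing.isLinear.Build R (universal_base d gR) B' _ poleval poleval_linear)
    (GRing.isMonoidMorphism.Build (universal_base d gR) B' poleval
       poleval_morphism).

Fact poleval_hom n x : base_grading (universal_base d gR) n x ->
  base_grading B' n (poleval_lr x).
Proof.
move=> hx; rewrite /= /poleval mmapE; apply: hom_sum => k _ _.
rewrite -[n](subrK (mondeg d k)); apply: homM (moneval_hom k).
by apply: base_scalar; apply: hx.
Qed.

Fact poleval_aug x : aug B' (poleval_lr x) = aug (universal_base d gR) x.
Proof.
rewrite /= /poleval mmapE rmorph_sum [X in mcoeff _ X]monalgE.
rewrite raddf_sum.
apply: eq_bigr => k _.
by rewrite rmorphM aug_scalar moneval_aug mulr_natr /= mcoeffU.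
Qed.

Definition poleval_base : base_morphism (universal_base d gR) B' :=
  BaseMorphism poleval_hom poleval_aug.

Lemma poleval_wvar i : poleval_base (wvar R i) = w i.
Proof. by rewrite /= /poleval mmapU monevalU /= scale1r mul1r. Qed.

End Evaluation.

Lemma malgUZ (R : comNzRingType) (K : monomType) (c : R) (k : K) :
  << c *g k >> = c *: << k >> :> {malg R[K]}.
Proof. by apply/malgP => k'; rewrite mcoeffZ mcoeffU mcoeffU1 mulr_natr. Qed.

Lemma malgUM (R : comNzRingType) (K : monomType) (k k' : K) :
  << mmul k k' >> = << k >> * << k' >> :> {malg R[K]}.
Proof. by rewrite malgM_def fgmulUU mulr1. Qed.

(** By linearity it is enough to compare on monomials, and these are handled by
induction on the degree, splitting off one variable. *)
Lemma base_morphism_ext (d : int) (R : comNzRingType) (gR : even_grading R)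
    (B' : base gR) (f g : base_morphism (universal_base d gR) B') :
  (forall i, f (wvar R i) = g (wvar R i)) -> f =1 g.
Proof.
move=> fg p; rewrite [p]monalgE !rmorph_sum; apply: eq_bigr => k _ /=.
rewrite malgUZ !linearZ /=; congr (_ *: _); move: k => k {p}.
elim: {k}(mdeg k) {-2}k (erefl (mdeg k)) => [|n IH] k.
  by move/mdeg_eq0I ->; rewrite !rmorph1.
have [e|[i ik]] := fset_0Vmem (finsupp k).
  by rewrite mdegE e big_seq_fset0.
have -> : k = mmul (ucm i) (divcm k (ucm i)).
  apply/eqP/cmP => j; rewrite cmM ucmE divcmE ucmE.
  by rewrite subnKC //; case: eqP => [<-|//]; rewrite lt0n cmE_neq0.
rewrite mdegM mdegU => -[/IH e].
set k' := divcm _ _ in e *.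
by rewrite malgUM !rmorphM; congr (_ * _); [exact: fg | exact: e].
Qed.

(** * Moore structures *)

Section MooreOperators.
Variables (L : comNzRingType) (d : int).
Hypothesis hd : odd `|d|.
Implicit Types (v w c : nat -> L).

Lemma evseries_nseq c i : evseries c (nseq i.*2.+2 Tt) = c i.
Proof. by rewrite /evseries tseries_nseq /= odd_double doubleK. Qed.

Lemma evseries0 : evseries (fun=> 0) = 0 :> ncps L.
Proof. by rewrite -tseries0; apply: eq_tseries => j; rewrite if_same. Qed.

Lemma evseries_inj v w : evseries v = evseries w -> v =1 w.
Proof. by move=> e i; rewrite -(evseries_nseq v) e evseries_nseq. Qed.

Lemma moore_op_tau v w :
  moore_op d v w (gen L Tau) = evseries w + gen L Tau ^+ 2.
Proof. by rewrite moore_opE // odd_der_gen. Qed.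

Lemma moore_op_t v w : moore_op d v w (gen L Tt) =
  evseries v + (gen L Tau * gen L Tt + gen L Tt * gen L Tau).
Proof. by rewrite moore_opE // odd_der_gen. Qed.

Lemma moore_opD v w x y :
  moore_op d v w (x + y) = moore_op d v w x + moore_op d v w y.
Proof. by rewrite moore_opE // odd_derD. Qed.

End MooreOperators.

Lemma pushout_moore (d : int) (R : comNzRingType) (gR : even_grading R)
    (B B' : base gR) (f : base_morphism B B') (v w : nat -> B) : odd `|d| ->
  pushout d f (moore_op d v w) = moore_op d (f \o v) (f \o w).
Proof.
move=> hd; rewrite /pushout moore_op_tau // moore_op_t // moore_opE //.
by congr odd_der;
  rewrite !(map_ncpsD, map_evseries, expr2, map_ncpsM, map_ncps_gen).
Qed.

(** Comparing the values on tau and on t shows that a deformation of the trivial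
structure has all its coefficients in the augmentation ideal. *)
Lemma deformation_trivial (d : int) (R : comNzRingType) (gR : even_grading R)
    (B : base gR) (v w : nat -> B) : odd `|d| ->
    (forall x, map_ncps (aug B) (moore_op d v w x) =
       moore_op d (fun=> 0) (fun=> 0) (map_ncps (aug B) x)) ->
  (forall i, aug B (v i) = 0) /\ (forall i, aug B (w i) = 0).
Proof.
move=> hd h; have := h (gen B Tt); have := h (gen B Tau).
rewrite !map_moore_op // !map_ncps_gen !moore_op_tau // !moore_op_t //.
by move=> /addIr /evseries_inj ew /addIr /evseries_inj ev; split.
Qed.

(** * Removing the coefficients v *)

Section Gauge.
Variables (L : comNzRingType) (d : int) (h : L).
Hypotheses (hd : odd `|d|) (h2 : h * 2%:R = 1).
Variables v w : nat -> L.

(** The coefficients of V / (2t), h being the inverse of 2: for j = 2i+1 the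
coefficient of t^(j+1) = t^(2(i+1)) in V is v i. *)
Definition gauge_coef j : L := if odd j then h * v j./2 else 0.
Definition gauge : ncps L := tseries gauge_coef.
(** The coefficients of W + G^2, the sum being the coefficient of t^(2i+2) in
G^2. *)
Definition gauge_w i : L :=
  w i + \sum_(k < i.*2.+3) gauge_coef k * gauge_coef (i.*2.+2 - k)%N.

Lemma gauge_tau_nil : (gen L Tau + gauge) [::] = 0.
Proof. by rewrite ncpsDE /gauge tseries_nil addr0. Qed.

Lemma evseries_gauge : evseries v = gen L Tt * gauge + gen L Tt * gauge.
Proof.
rewrite gen_mul_tseries tseriesD; apply: eq_tseries => -[|j] /=.
  by rewrite addr0.
rewrite /gauge_coef negbK uphalf_half; case: (odd j); last by rewrite addr0.
by rewrite -mulr2n -mulr_natr mulrAC h2 mul1r.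
Qed.

(** Since G is odd in t, its square only has terms of positive even degree, so
that it is of the form of the series W. *)
Lemma evseries_gauge_w : evseries gauge_w = evseries w + gauge * gauge.
Proof.
rewrite /gauge tseriesM tseriesD; apply: eq_tseries => j.
have [oj|ej] := boolP (odd j).
  rewrite andbF add0r big1 // => i _.
  rewrite /gauge_coef (oddB (_ : i <= j)%N) ?oj; last by rewrite -ltnS.
  by case: (odd i); rewrite /= ?mul0r ?mulr0.
case: j ej => [|[//|j]] /= ej.
  by rewrite big_ord_recl big_ord0 /gauge_coef /= mul0r !addr0.
rewrite negbK in ej; rewrite /gauge_w.
by have -> // : (j./2).*2 = j; apply: even_halfK.
Qed.

(** V d/dt sends G to V G / t, which is 2 G^2 since V = 2 t G. *)
Lemma moore_op_gauge : moore_op d v w gauge =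
  gauge * gauge + gauge * gauge + (gen L Tau * gauge + gauge * gen L Tau).
Proof.
rewrite moore_op_tseries // => [|j /negbTE oj]; last by rewrite /gauge_coef oj.
congr (_ + _); have e : gen L Tt * tseries (fun j => gauge_coef j.+1) = gauge.
  by rewrite gen_mul_tseries; apply: eq_tseries => -[].
by rewrite evseries_gauge gen_tseriesC mulrDl -mulrA e.
Qed.

(** On tau, both sides equal W + 2 G^2 + tau^2 + tau G + G tau; on t, both equal
V + tau t + t tau, the term V being 2 t G on the left. *)
Lemma gauge_transform x :
  subst (gen L Tau + gauge) (gen L Tt) (moore_op d (fun=> 0) gauge_w x) =
  moore_op d v w (subst (gen L Tau + gauge) (gen L Tt) x).
Proof.
have A0 := gauge_tau_nil; rewrite !moore_opE //; apply: odd_der_subst => //.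
- rewrite gsignD gsign_gen // gsign_tseries // opprD tseriesN; congr (_ + _).
  apply: eq_tseries => j; rewrite -signr_odd /gauge_coef.
  by case: odd; rewrite ?expr1 ?mulN1r // mulr0 oppr0.
- exact: gsign_gen.
- rewrite -moore_opE // moore_opD // moore_op_tau // moore_op_gauge.
  rewrite expr2 substD // substM // subst_gen // subst_tseries //.
  rewrite -/(evseries _) evseries_gauge_w mulrDl !mulrDr.
  set a := evseries w; set b := gauge * gauge; set t2 := gen L Tau * gen L Tau.
  set x1 := gen L Tau * gauge; set x2 := gauge * gen L Tau.
  by rewrite [LHS](AC (2*(2*2)) ((1*3)*((2*6)*(4*5)))).
- rewrite -moore_opE // moore_op_t // evseries0 add0r substD // !substM //.
  rewrite !subst_gen // mulrDl mulrDr evseries_gauge /gauge -gen_tseriesC.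
  by rewrite addrACA addrC.
Qed.

(** The inverse is the substitution attached to -G: both substitutions fix
series in t, hence they fix G. *)
Lemma gauge_bijective : bijective (subst (gen L Tau + gauge) (gen L Tt)).
Proof.
have A0 := gauge_tau_nil; have A0' : (gen L Tau - gauge) [::] = 0.
  by rewrite ncpsBE /gauge tseries_nil subr0.
exists (subst (gen L Tau - gauge) (gen L Tt)) => x.
  rewrite subst_comp // substD // !subst_gen // subst_tseries // subrK.
  exact: subst_id.
rewrite subst_comp // -[- gauge]scaleN1r substD // substZ // !subst_gen //.
by rewrite subst_tseries // scaleN1r addrK subst_id.
Qed.

Variable gL : even_grading L.
Hypothesis h0 : gL 0 h.
Hypothesis hv : forall i, gL (vcoefdeg d i) (v i).
Hypothesis hw : forall i, gL (wcoefdeg d i) (w i).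

Lemma gauge_coef_hom j : gL (-1 + j%:Z * (d + 2)) (gauge_coef j).
Proof.
rewrite /gauge_coef; case: ifP => oj; last exact: hom0.
have -> : -1 + j%:Z * (d + 2) = 0 + vcoefdeg d j./2; last exact: homM.
rewrite /vcoefdeg -[in LHS](odd_double_half j) oj -muln2; lia.
Qed.

Lemma gauge_w_hom i : gL (wcoefdeg d i) (gauge_w i).
Proof.
apply: homD => //; apply: hom_sum => k _ _.
have -> : wcoefdeg d i = (-1 + (k : nat)%:Z * (d + 2))
    + (-1 + (i.*2.+2 - k)%:Z * (d + 2)); last first.
  by apply: homM; apply: gauge_coef_hom.
have -> : (i.*2.+2 - k)%:Z = i.*2.+2%:Z - (k : nat)%:Z.
  by have := ltn_ord k; lia.
have -> : i.*2.+2%:Z = (2 * i.+1)%:Z by congr Posz; lia.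
rewrite /wcoefdeg; ring.
Qed.

End Gauge.

(** * Square-zero augmentation ideals *)

Section Infinitesimal.
Variables (L K : comNzRingType) (e : {rmorphism L -> K}).
Hypothesis e2 : forall x y, e x = 0 -> e y = 0 -> x * y = 0.
Implicit Types (x y : ncps L).
Local Notation inker x := (forall u, e (x u) = 0).

Lemma inker_mul x y : inker x -> inker y -> x * y = 0.
Proof.
by move=> hx hy; apply/funext => u; rewrite ncpsME big1 // => i _; apply: e2.
Qed.

Lemma inker_tseries c : (forall j, e (c j) = 0) -> inker (tseries c).
Proof. by move=> hc u; rewrite /tseries; case: ifP; rewrite ?rmorph0. Qed.

Lemma inker_evseries c : (forall j, e (c j) = 0) -> inker (evseries c).
Proof.
by move=> hc; apply: inker_tseries => j; case: ifP; rewrite ?rmorph0.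
Qed.

(** For a finite series, write x = tau x' + t x'' up to a constant: by induction
phi fixes x' and x'', and replacing phi(tau), phi(t) by tau, t costs products
of two elements of the ideal. Continuity extends this to all series. *)
Lemma inker_fixed (phi : {lrmorphism ncps L -> ncps L}) x :
    ncps_continuous phi ->
    (forall y, map_ncps e (phi y) = map_ncps e y) -> inker x ->
  phi x = x.
Proof.
move=> cphi ephi hx.
have fin M y : (forall u, (M <= size u)%N -> y u = 0) -> inker y -> phi y = y.
  elim: M y => [|M IH] y ym hy.
    by rewrite (_ : y = 0) ?rmorph0 //; apply/funext => u; apply: ym.
  have phiZ l : phi (gen L l) * lquo l y = gen L l * lquo l y.
    apply/eqP; rewrite -subr_eq0 -mulrBl inker_mul // => u; last exact: hy.
    rewrite ncpsBE rmorphB; apply/eqP; rewrite subr_eq0; apply/eqP.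
    exact: (congr1 (@^~ u) (ephi _)).
  have phil l : phi (lquo l y) = lquo l y.
    by apply: IH => u => [su|]; [apply: ym | apply: hy].
  rewrite {1}[y]ncps_dec !rmorphD !rmorphM /= !phil !phiZ linearZ rmorph1 /=.
  by rewrite -ncps_dec.
(* The truncation y of x is long enough for phi y and y to have the same
   coefficients at u as phi x and x. *)
apply/funext => u; have [M hM] := cphi x (size u).+1.
pose y : ncps L :=
  fun u' => if (size u' < maxn M (size u).+1)%N then x u' else 0.
rewrite -(hM y) => [||//]; last first.
  by move=> u' su'; rewrite /y leq_max su'.
rewrite (fin (maxn M (size u).+1)) => [||u'].
- by rewrite /y leq_max ltnSn orbT.
- by move=> u' su'; rewrite /y ltnNge su'.
- by rewrite /y; case: ifP; rewrite ?rmorph0.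
Qed.

Lemma mul_gen_tau_nseq x j : (x * gen L Tau) (nseq j Tt) = 0.
Proof.
rewrite ncpsME big1 // => i _; rewrite drop_nseq.
by case: (j - i)%N => [|[|k]] /=; rewrite mulr0.
Qed.

Lemma gen_tau_mul_nseq x j : (gen L Tau * x) (nseq j Tt) = 0.
Proof. by rewrite gen_mul; case: j. Qed.

(** With c the coefficients of G, applying the intertwining relation to tau
gives W + tau^2 + tau G + G tau = W' + tau^2 + [tau, G], the terms G^2 and
V d/dt (G) being 0; apart from W and W', all terms are multiples of tau and
vanish at the powers of t. *)
Lemma infinitesimal_rigid d v w w' c (phi : {lrmorphism ncps L -> ncps L}) :
    odd `|d| -> (forall i, e (v i) = 0) -> (forall i, e (w i) = 0) ->
    ncps_continuous phi -> (forall y, map_ncps e (phi y) = map_ncps e y) ->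
    phi (gen L Tau) = gen L Tau + tseries c ->
    (forall x, phi (moore_op d (fun=> 0) w x) = moore_op d v w' (phi x)) ->
  w =1 w'.
Proof.
move=> hd ev ew cphi ephi phit phim.
have ec j : e (c j) = 0.
  have := congr1 (@^~ (nseq j Tt)) (ephi (gen L Tau)).
  rewrite phit map_ncpsD /= ncpsDE => /(canRL (addKr _)).
  by rewrite addNr map_tseries tseries_nseq.
apply: evseries_inj; apply: eq_tseries => j.
have := congr1 (@^~ (nseq j Tt)) (phim (gen L Tau)).
rewrite moore_op_tau // rmorphD /= (inker_fixed cphi ephi (inker_evseries ew)).
rewrite rmorphXn /= phit moore_opD // moore_op_tau //.
rewrite /moore_op !odd_der_tau_tseries // odd_der_t_tseries //.
rewrite inker_mul; first last.
- by apply: inker_tseries => k; case: ifP; rewrite ?rmorph0.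
- exact: inker_evseries.
rewrite expr2 mulrDl mulrDr [tseries c * (_ + _)]mulrDr.
rewrite (inker_mul (inker_tseries ec) (inker_tseries ec)).
rewrite !(addr0, subr0, add0r).
rewrite /ad_tau !ncpsDE ncpsNE !mul_gen_tau_nseq !gen_tau_mul_nseq.
by rewrite expr2 gen_tau_mul_nseq oppr0 !addr0 /evseries !tseries_nseq.
Qed.

End Infinitesimal.

(** * Miniversality *)

Lemma wvar_hom (R : comNzRingType) (gR : even_grading R) (d : int) i :
  base_grading (universal_base d gR) (wcoefdeg d i) (wvar R i).
Proof.
apply: pol_homU; rewrite /mondeg mdomU big_seq_fset1 cmUU mul1r subrr.
exact: hom1.
Qed.

Lemma universal_deformation (R : comNzRingType) (gR : even_grading R)
    (d : int) : odd (absz d) ->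
  is_deformation (gR := gR) d
    (moore_op d (fun _ : nat => 0 : R) (fun _ : nat => 0 : R))
    (B := universal_base d gR)
    (moore_op d (fun _ : nat => 0 : universal_base d gR) (wvar R)).
Proof.
move=> hd; split=> [|x].
  exists (fun=> 0), (wvar R); split=> // i; [exact: hom0 | exact: wvar_hom].
rewrite map_moore_op //; congr (moore_op d _ _ _); apply/funext => i /=.
  exact: rmorph0.
by rewrite mcoeffU cm1_eq1.
Qed.

(** The degree condition on the substitution uses that half of v is homogeneous
of the degree of v, and its compatibility with the augmentation that the
coefficients v lie in the augmentation ideal. *)
Lemma gauge_equivalent (R : comNzRingType) (gR : even_grading R) (d : int)
    (B : base gR) (h : B) (v w : nat -> B) : odd (absz d) -> h * 2%:R = 1 ->
    (forall i, base_grading B (vcoefdeg d i) (v i)) ->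
    (forall i, aug B (v i) = 0) ->
  equivalent d (moore_op d (fun=> 0) (gauge_w h v w)) (moore_op d v w).
Proof.
move=> hd h2 hv av; have A0 := gauge_tau_nil h v.
have B0 : gen B Tt [::] = 0 by [].
have h0 := hom_half (base_grading B) h2.
exists (subst_lrmorphism A0 B0); split.
- by split; [exact: gauge_bijective | exact: subst_continuous].
- move=> n x hx; apply: ncps_hom_subst => //; last exact: ncps_hom_gen.
  apply: ncps_homD; first exact: ncps_hom_gen.
  by apply: ncps_hom_tseries => j; apply: gauge_coef_hom.
- exists (gauge_coef h v), (fun j => (j == 1%N)%:R); split.
  + by split=> //=; rewrite subst_gen.
  + by split=> //=; rewrite subst_gen // gen_tseries.
  + by exists 1; rewrite mulr1.
- exact: gauge_transform.
- move=> x; rewrite [LHS]map_subst // map_ncpsD !map_ncps_gen map_tseries.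
  have -> : tseries (aug B \o gauge_coef h v) = 0.
    rewrite -tseries0; apply: eq_tseries => j /=; rewrite /gauge_coef.
    by case: ifP; rewrite ?rmorph0 // rmorphM av mulr0.
  by rewrite addr0 subst_id.
Qed.

Theorem theorem6p2 (R : comNzRingType) (gR : even_grading R)
    (h2 : exists h : R, h * 2%:R = 1) (d : int) (hd : odd (absz d)) :
  miniversal (gR := gR) d
    (moore_op d (fun _ : nat => 0 : R) (fun _ : nat => 0 : R))
    (B := universal_base d gR)
    (moore_op d (fun _ : nat => 0 : universal_base d gR) (wvar R)).
Proof.
have [h hh] := h2; split; first split.
- exact: universal_deformation.
- move=> B' mB' [[v [w [hv hw ->]]] /(deformation_trivial hd)[av aw]].
  pose k : B' := h%:A; have k2 : k * 2%:R = 1.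
    by rewrite /k -scalerAl mul1r -[2%:R]scaler_nat scalerA hh scale1r.
  have hg i : base_grading B' (wcoefdeg d i) (gauge_w k v w i).
    by apply: gauge_w_hom => //; apply: hom_half.
  have ag i : aug B' (gauge_w k v w i) = 0.
    rewrite rmorphD aw add0r rmorph_sum big1 // => j _.
    rewrite rmorphM /gauge_coef; case: ifP; last by rewrite rmorph0 mul0r.
    by rewrite rmorphM av mulr0 mul0r.
  exists (poleval_base hg ag); rewrite pushout_moore //.
  have -> : poleval_base hg ag \o (fun _ : nat => 0) = (fun=> 0).
    by apply/funext => i; apply: (rmorph0 (poleval_base hg ag)).
  have -> : poleval_base hg ag \o wvar R = gauge_w k v w.
    by apply/funext => i; apply: poleval_wvar.
  exact: gauge_equivalent.
- move=> B' mB' [[v [w [_ _ ->]]] /(deformation_trivial hd)[av aw]] inf.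
  suff key (f : base_morphism (universal_base d gR) B') :
      equivalent d (pushout d f
        (moore_op d (fun _ : nat => 0 : universal_base d gR) (wvar R)))
        (moore_op d v w) -> forall i, f (wvar R i) = w i.
    move=> f g /key ef /key eg; apply: base_morphism_ext => i.
    by rewrite ef eg.
  rewrite pushout_moore //.
  move=> [phi [[_ cphi] _ [G [F [[_ phit] _ _]]] phim ephi]].
  apply: (infinitesimal_rigid (e := aug B') (v := v) _ hd) phit _ => //.
  + by move=> i; rewrite base_map_aug /= mcoeffU cm1_eq1.
  + move=> x; rewrite -phim; congr (phi (moore_op _ _ _ _)).
    by apply/funext => i /=; rewrite rmorph0.
Qed.
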